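(* If the sequent $\Gamma^{K^+}, \neg \Delta^{K^-} \vdash D^{K^-}$ is provable in the intuitionistic sequent calculus, then $\Gamma \vdash \Delta, D$ is provable in the classical sequent calculus.
   Context: First-order logic with connectives $\wedge,\vee,\Rightarrow,\neg$ and quantifiers $\forall,\exists$. The classical sequent calculus is the usual cut-free multi-conclusion sequent calculus (sequents $\Gamma\vdash\Delta$ of multisets, axiom $\Gamma,A\vdash A,\Delta$, left/right rules for each connective and quantifier, contraction and weakening on both sides, no cut). The intuitionistic sequent calculus is its cut-free restriction where the right-hand side contains at most one formula (no right contraction, $\Delta$ empty in the axiom and in the first premiss of $\Rightarrow_L$, and $\vee_R$ split into two rules choosing a disjunct). The polarized Kolmogorov translations are defined by induction: for $A$ atomic, $A^{K^+}\equiv A$ and $A^{K^-}\equiv A$; $(A\wedge B)^{K^+}\equiv A^{K^+}\wedge B^{K^+}$, $(A\wedge B)^{K^-}\equiv \neg\neg A^{K^-}\wedge\neg\neg B^{K^-}$; $(A\vee B)^{K^+}\equiv A^{K^+}\vee B^{K^+}$, $(A\vee B)^{K^-}\equiv \neg\neg A^{K^-}\vee\neg\neg B^{K^-}$; $(A\Rightarrow B)^{K^+}\equiv \neg\neg A^{K^-}\Rightarrow B^{K^+}$, $(A\Rightarrow B)^{K^-}\equiv A^{K^+}\Rightarrow\neg\neg B^{K^-}$; $(\neg A)^{K^+}\equiv\neg A^{K^-}$, $(\neg A)^{K^-}\equiv\neg A^{K^+}$; $(\forall x A)^{K^+}\equiv\forall x A^{K^+}$, $(\forall x A)^{K^-}\equiv\forall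 x\neg\neg A^{K^-}$; $(\exists x A)^{K^+}\equiv\exists x A^{K^+}$, $(\exists x A)^{K^-}\equiv\exists x\neg\neg A^{K^-}$. Translations and negations of multisets are applied formula by formula. $D$ is a formula. *)

(* Defs.v *)
From Stdlib Require Import List Permutation.
From Stdlib Require Vector.
Import ListNotations.

Set Implicit Arguments.
Unset Strict Implicit.
Unset Printing Implicit Defensive.

Record signature := Signature {
  fun_sym : Type;
  fun_arity : fun_sym -> nat;
  pred_sym : Type;
  pred_arity : pred_sym -> nat
}.

(* Variables are de Bruijn indices, so that alpha-equivalent formulas are
   equal: [Forall A] and [Exists A] bind index 0 of [A]. *)
Inductive term (S : signature) : Type :=
| Var (n : nat)
| App (f : fun_sym S) (args : Vector.t (term S) (fun_arity f)).

Inductive formula (S : signature) : Type :=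
| Atom (P : pred_sym S) (args : Vector.t (term S) (pred_arity P))
| And (A B : formula S)
| Or (A B : formula S)
| Imp (A B : formula S)
| Neg (A : formula S)
| Forall (A : formula S)
| Exists (A : formula S).

Arguments Var {S} n.

Section Syntax.
Variable S : signature.

Fixpoint subst_term (s : nat -> term S) (t : term S) : term S :=
  match t with
  | Var n => s n
  | App args => App (Vector.map (subst_term s) args)
  end.

Definition shift_term : term S -> term S := subst_term (fun n => Var (1 + n)).

(* The substitution to apply under a binder. *)
Definition up (s : nat -> term S) (n : nat) : term S :=
  match n with
  | 0 => Var 0
  | Datatypes.S n => shift_term (s n)
  end.

Fixpoint subst (s : nat -> term S) (A : formula S) : formula S :=
  match A with
  | Atom args => Atom (Vector.map (subst_term s) args)
  | And A B => And (subst s A) (subst s B)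
  | Or A B => Or (subst s A) (subst s B)
  | Imp A B => Imp (subst s A) (subst s B)
  | Neg A => Neg (subst s A)
  | Forall A => Forall (subst (up s) A)
  | Exists A => Exists (subst (up s) A)
  end.

Definition shift : formula S -> formula S := subst (fun n => Var (1 + n)).

(* [inst t A] is A[t/x], where x is the variable of index 0 in [A], bound in
   [Forall A] and [Exists A]; the other free indices are decremented. *)
Definition inst (t : term S) : formula S -> formula S :=
  subst (fun n => match n with 0 => t | Datatypes.S n => Var n end).

End Syntax.

(* Multisets of formulas are lists up to the exchange rule [lk_exch]
   (respectively [lj_exch]); the principal formula is put at the head.
   In [lk_allR] and [lk_exL], the eigenvariable is index 0: shifting the
   context makes it fresh there, and the premiss contains the body A of the
   quantified formula, in which index 0 is the formerly bound variable. *)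
Inductive lk (S : signature) : list (formula S) -> list (formula S) -> Prop :=
| lk_exch G G' D D' :
    Permutation G G' -> Permutation D D' -> lk G D -> lk G' D'
| lk_ax G D A : lk (A :: G) (A :: D)
| lk_andL G D A B : lk (A :: B :: G) D -> lk (And A B :: G) D
| lk_andR G D A B : lk G (A :: D) -> lk G (B :: D) -> lk G (And A B :: D)
| lk_orL G D A B : lk (A :: G) D -> lk (B :: G) D -> lk (Or A B :: G) D
| lk_orR G D A B : lk G (A :: B :: D) -> lk G (Or A B :: D)
| lk_impL G D A B : lk G (A :: D) -> lk (B :: G) D -> lk (Imp A B :: G) D
| lk_impR G D A B : lk (A :: G) (B :: D) -> lk G (Imp A B :: D)
| lk_negL G D A : lk G (A :: D) -> lk (Neg A :: G) D
| lk_negR G D A : lk (A :: G) D -> lk G (Neg A :: D)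
| lk_allL G D A t : lk (inst t A :: G) D -> lk (Forall A :: G) D
| lk_allR G D A :
    lk (map (@shift S) G) (A :: map (@shift S) D) -> lk G (Forall A :: D)
| lk_exL G D A :
    lk (A :: map (@shift S) G) (map (@shift S) D) -> lk (Exists A :: G) D
| lk_exR G D A t : lk G (inst t A :: D) -> lk G (Exists A :: D)
| lk_contrL G D A : lk (A :: A :: G) D -> lk (A :: G) D
| lk_contrR G D A : lk G (A :: A :: D) -> lk G (A :: D)
| lk_weakL G D A : lk G D -> lk (A :: G) D
| lk_weakR G D A : lk G D -> lk G (A :: D).

(* The right-hand side, which has at most one formula, is an [option]. *)
Inductive lj (S : signature) :
    list (formula S) -> option (formula S) -> Prop :=
| lj_exch G G' D : Permutation G G' -> lj G D -> lj G' D
| lj_ax G A : lj (A :: G) (Some A)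
| lj_andL G D A B : lj (A :: B :: G) D -> lj (And A B :: G) D
| lj_andR G A B : lj G (Some A) -> lj G (Some B) -> lj G (Some (And A B))
| lj_orL G D A B : lj (A :: G) D -> lj (B :: G) D -> lj (Or A B :: G) D
| lj_orR1 G A B : lj G (Some A) -> lj G (Some (Or A B))
| lj_orR2 G A B : lj G (Some B) -> lj G (Some (Or A B))
| lj_impL G D A B : lj G (Some A) -> lj (B :: G) D -> lj (Imp A B :: G) D
| lj_impR G A B : lj (A :: G) (Some B) -> lj G (Some (Imp A B))
| lj_negL G A : lj G (Some A) -> lj (Neg A :: G) None
| lj_negR G A : lj (A :: G) None -> lj G (Some (Neg A))
| lj_allL G D A t : lj (inst t A :: G) D -> lj (Forall A :: G) D
| lj_allR G A : lj (map (@shift S) G) (Some A) -> lj G (Some (Forall A))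
| lj_exL G D A :
    lj (A :: map (@shift S) G) (option_map (@shift S) D) ->
    lj (Exists A :: G) D
| lj_exR G A t : lj G (Some (inst t A)) -> lj G (Some (Exists A))
| lj_contrL G D A : lj (A :: A :: G) D -> lj (A :: G) D
| lj_weakL G D A : lj G D -> lj (A :: G) D
| lj_weakR G A : lj G None -> lj G (Some A).

(* [kpos A] is A^{K+} and [kneg A] is A^{K-}. *)
Fixpoint kpos (S : signature) (A : formula S) : formula S :=
  match A with
  | Atom args => Atom args
  | And A B => And (kpos A) (kpos B)
  | Or A B => Or (kpos A) (kpos B)
  | Imp A B => Imp (Neg (Neg (kneg A))) (kpos B)
  | Neg A => Neg (kneg A)
  | Forall A => Forall (kpos A)
  | Exists A => Exists (kpos A)
  end
with kneg (S : signature) (A : formula S) : formula S :=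
  match A with
  | Atom args => Atom args
  | And A B => And (Neg (Neg (kneg A))) (Neg (Neg (kneg B)))
  | Or A B => Or (Neg (Neg (kneg A))) (Neg (Neg (kneg B)))
  | Imp A B => Imp (kpos A) (Neg (Neg (kneg B)))
  | Neg A => Neg (kpos A)
  | Forall A => Forall (Neg (Neg (kneg A)))
  | Exists A => Exists (Neg (Neg (kneg A)))
  end.

(* Main.v *)
(** Reading [kpos A] on the left as the classical hypothesis A, [Neg (kneg A)]
    on the left as the classical conclusion A, and [kneg A] or
    [Neg (Neg (kneg A))] on the right as the classical conclusion A, every
    sequent of a cut-free intuitionistic proof can be read in this way, and each
    intuitionistic rule becomes a classical rule, a weakening, or the identity
    (for the rules on the added negations).  The only other point is the axiom:
    [kpos A = kneg B] does not imply A = B (A may carry double negations that B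
    lacks), so it is read as A |- B, which is proved by induction on the
    common translation. *)

Require Import Defs.
From Stdlib Require Import List Permutation.
From Stdlib Require Vector.
Import ListNotations.

Set Implicit Arguments.
Unset Strict Implicit.
Unset Printing Implicit Defensive.

(** * Substitution and its commutation with the translations *)

Lemma subst_term_cancel (S : signature) (r s : nat -> term S) :
  (forall n, exists k, r n = Var k /\ s k = Var n) ->
  forall t, subst_term s (subst_term r t) = t.
Proof.
  intros Hrs.
  fix IH 1; intros [n | f args]; simpl.
  - destruct (Hrs n) as (k & -> & Hk); exact Hk.
  - f_equal.
    induction args as [| t n args IHargs]; simpl; f_equal; auto.
Qed.

(** The values of [r] are required to be variables so that passing under a binder is plain
    computation, with no law for composing substitutions. *)
Lemma up_cancel (S : signature) (r s : nat -> term S) :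
  (forall n, exists k, r n = Var k /\ s k = Var n) ->
  forall n, exists k, up r n = Var k /\ up s k = Var n.
Proof.
  intros Hrs [| n].
  - now exists 0.
  - destruct (Hrs n) as (k & Hr & Hs).
    exists (1 + k); simpl; now rewrite Hr, Hs.
Qed.

Lemma subst_cancel (S : signature) (A : formula S) (r s : nat -> term S) :
  (forall n, exists k, r n = Var k /\ s k = Var n) ->
  subst s (subst r A) = A.
Proof.
  revert r s; induction A; intros r s Hrs; simpl; f_equal;
    auto using up_cancel.
  induction args as [| t n args IHargs]; simpl; f_equal;
    auto using subst_term_cancel.
Qed.

(** Serves the quantifier cases of the axiom: once an eigenvariable rule has shifted the other
    quantified formula, instantiating that formula with the eigenvariable recovers its body. *)
Lemma inst_Var0_up_shift (S : signature) (A : formula S) :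
  inst (Var 0) (subst (up (fun n => Var (1 + n))) A) = A.
Proof.
  (* Index [1 + n] is renamed to [2 + n], which [inst] lowers again. *)
  apply subst_cancel; intros [| n]; [now exists 0 | now exists (2 + n)].
Qed.

(** Both halves go through one induction because implication and negation exchange the
    polarities. *)
Lemma kpos_kneg_subst (S : signature) (A : formula S) (s : nat -> term S) :
  kpos (subst s A) = subst s (kpos A) /\ kneg (subst s A) = subst s (kneg A).
Proof.
  revert s; induction A as [| A IHA B IHB | A IHA B IHB | A IHA B IHB
    | A IHA | A IHA | A IHA]; intros s; simpl; auto;
    try destruct (IHA s) as [-> ->]; try destruct (IHB s) as [-> ->];
    try destruct (IHA (up s)) as [-> ->]; auto.
Qed.

Lemma kpos_subst (S : signature) (s : nat -> term S) (A : formula S) :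
  kpos (subst s A) = subst s (kpos A).
Proof. apply kpos_kneg_subst. Qed.

Lemma kneg_subst (S : signature) (s : nat -> term S) (A : formula S) :
  kneg (subst s A) = subst s (kneg A).
Proof. apply kpos_kneg_subst. Qed.

(** * Structural rules of the classical calculus *)

Lemma lk_weaken (S : signature) (G D G' D' : list (formula S)) :
  lk G D -> lk (G ++ G') (D ++ D').
Proof.
  intros H.
  apply lk_exch with (G' ++ G) (D' ++ D);
    [apply Permutation_app_comm | apply Permutation_app_comm |].
  induction G' as [| A G' IHG]; simpl; [| now apply lk_weakL].
  induction D' as [| A D' IHD]; simpl; [| apply lk_weakR]; auto.
Qed.

Lemma lk_weakenR (S : signature) (G D D' : list (formula S)) :
  lk G D -> lk G (D ++ D').
Proof. intros H; rewrite <- (app_nil_r G); now apply lk_weaken. Qed.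

Lemma lk_exchR (S : signature) (G D D' : list (formula S)) :
  Permutation D D' -> lk G D -> lk G D'.
Proof. now apply lk_exch. Qed.

Lemma lk_weakenL (S : signature) (G G' D : list (formula S)) :
  lk G D -> lk (G ++ G') D.
Proof. intros H; rewrite <- (app_nil_r D); now apply lk_weaken. Qed.

Lemma lk_exchL (S : signature) (G G' D : list (formula S)) :
  Permutation G G' -> lk G D -> lk G' D.
Proof. intros HG; now apply lk_exch. Qed.

(** * Reading intuitionistic sequents as classical ones *)

(* [inl A] is the classical hypothesis A, [inr A] the classical conclusion A. *)
Definition hyp (S : signature) (a : formula S + formula S) : formula S :=
  match a with inl A => kpos A | inr A => Neg (kneg A) end.

Definition lefts (S : signature) : list (formula S + formula S) ->
    list (formula S) :=
  flat_map (fun a => match a with inl A => [A] | inr _ => [] end).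

Definition rights (S : signature) : list (formula S + formula S) ->
    list (formula S) :=
  flat_map (fun a => match a with inl _ => [] | inr A => [A] end).

(** Both forms occur: right rules on [kneg A] leave doubly negated parts on the right, while
    [lj_negL] on [Neg (kneg A)] leaves [kneg A] bare. *)
Inductive concl (S : signature) :
    option (formula S) -> list (formula S) -> Prop :=
| concl_none : concl None []
| concl_kneg A : concl (Some (kneg A)) [A]
| concl_nn A : concl (Some (Neg (Neg (kneg A)))) [A].

Definition shift_hyp (S : signature) (a : formula S + formula S) :
    formula S + formula S :=
  match a with inl A => inl (shift A) | inr A => inr (shift A) end.

Lemma hyp_shift (S : signature) (L : list (formula S + formula S)) :
  map (@hyp S) (map (@shift_hyp S) L) = map (@shift S) (map (@hyp S) L).
Proof.
  induction L as [| [A | A] L IH]; simpl; auto; rewrite IH; unfold shift;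
    [now rewrite kpos_subst | now rewrite kneg_subst].
Qed.

Lemma lefts_shift (S : signature) (L : list (formula S + formula S)) :
  lefts (map (@shift_hyp S) L) = map (@shift S) (lefts L).
Proof. induction L as [| [A | A] L IH]; simpl; congruence. Qed.

Lemma rights_shift (S : signature) (L : list (formula S + formula S)) :
  rights (map (@shift_hyp S) L) = map (@shift S) (rights L).
Proof. induction L as [| [A | A] L IH]; simpl; congruence. Qed.

Lemma concl_shift (S : signature) (R : option (formula S)) E :
  concl R E -> concl (option_map (@shift S) R) (map (@shift S) E).
Proof.
  intros []; simpl; unfold shift; simpl; rewrite <- ?kneg_subst; constructor.
Qed.

(** * Axioms up to translation *)

Lemma concl_Some_inv (S : signature) (F : formula S) E :
  concl (Some F) E ->
  exists B, E = [B] /\ (F = kneg B \/ F = Neg (Neg (kneg B))).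
Proof. inversion 1; subst; eauto. Qed.

(** Translations keep the outermost connective, so the head of the translated formula determines
    that of [A]. *)
Ltac case_translation A H :=
  destruct A; try discriminate H; simpl in H; injection H as H.

(** The induction covers all readings of [F] at once, because removing one negation can turn a
    doubly negated conclusion into an [inr] hypothesis. *)
Lemma lk_identity (S : signature) (F : formula S) a E :
  hyp a = F -> concl (Some F) E -> lk (lefts [a]) (E ++ rights [a]).
Proof.
  intros Ha HE.
  apply concl_Some_inv in HE; destruct HE as (C & -> & HC).
  revert a C Ha HC.
  induction F as [P args | F1 IH1 F2 IH2 | F1 IH1 F2 IH2 | F1 IH1 F2 IH2
    | F1 IH1 | F1 IH1 | F1 IH1]; intros [A | A] C Ha HC; simpl in Ha;
    try discriminate Ha; simpl.
  - destruct HC as [HC | HC]; [| discriminate HC].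
    destruct A; try discriminate Ha; destruct C; try discriminate HC.
    simpl in Ha, HC; rewrite Ha, HC; apply lk_ax.
  - destruct HC as [HC | HC]; [| discriminate HC].
    case_translation A Ha; case_translation C HC.
    apply lk_andL, lk_andR.
    + apply (lk_weakenL (G := [A1]) [A2]), (IH1 (inl A1)); auto.
    + apply lk_weakL, (IH2 (inl A2)); auto.
  - destruct HC as [HC | HC]; [| discriminate HC].
    case_translation A Ha; case_translation C HC.
    apply lk_orR, lk_orL.
    + apply (lk_weakenR (D := [C1]) [C2]), (IH1 (inl A1)); auto.
    + apply lk_weakR, (IH2 (inl A2)); auto.
  - destruct HC as [HC | HC]; [| discriminate HC].
    case_translation A Ha; case_translation C HC.
    apply lk_impR, lk_exchL with [Imp A1 A2; C1]; [apply perm_swap |].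
    apply lk_impL.
    (* [F1] is both [Neg (Neg (kneg A1))] and [kpos C1]: the antecedents change sides. *)
    + apply (lk_weakenR (D := [A1]) [C2]), (IH1 (inl C1)); auto.
    + apply (lk_weakenL (G := [A2]) [C1]), (IH2 (inl A2)); auto.
  - case_translation A Ha.
    apply lk_negL; destruct HC as [HC | HC].
    + case_translation C HC.
      apply lk_exchR with [Neg C; A]; [apply perm_swap |].
      apply lk_negR, (IH1 (inl C)); auto.
    (* Here [F1] is both [kneg A] and [Neg (kneg C)], so [A] is the new conclusion and [C] the
       hypothesis [inr C]. *)
    + injection HC as HC; apply (IH1 (inr C)); auto.
  - injection Ha as Ha.
    destruct HC as [HC | HC].
    + case_translation C HC.
      apply lk_negR, (IH1 (inl C)); auto.
    + injection HC as HC.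
      apply lk_exchR with [A; C]; [apply perm_swap |].
      apply (IH1 (inr C)); auto.
  - destruct HC as [HC | HC]; [| discriminate HC].
    case_translation A Ha; case_translation C HC.
    apply lk_allR; simpl; apply lk_allL with (Var 0).
    rewrite inst_Var0_up_shift; apply (IH1 (inl A)); auto.
  - destruct HC as [HC | HC]; [| discriminate HC].
    case_translation A Ha; case_translation C HC.
    apply lk_exL; simpl; apply lk_exR with (Var 0).
    rewrite inst_Var0_up_shift; apply (IH1 (inl A)); auto.
Qed.

(** * From intuitionistic to classical derivations *)

Ltac case_hyp L HL A HG :=
  destruct L as [| [A | A] L]; try discriminate HL; simpl in HL;
  injection HL as HL HG; symmetry in HL; case_translation A HL.

(** A principal formula that is not a negation excludes the reading [Neg (Neg (kneg C))] here, and
    the reading [inr A] in [case_hyp]. *)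
Ltac case_concl HE C HC :=
  apply concl_Some_inv in HE; destruct HE as (C & -> & HC);
  destruct HC as [HC | HC]; [| discriminate HC];
  symmetry in HC; case_translation C HC.

(** A single list of signed formulas lets exchange permute the whole context, and the sign of the
    head formula decides on which classical side a left rule acts. *)
Lemma lk_of_lj (S : signature) (G : list (formula S)) R :
  lj G R -> forall L E, G = map (@hyp S) L -> concl R E ->
  lk (lefts L) (E ++ rights L).
Proof.
  induction 1 as [G G' R HG _ IH | G F | G R F1 F2 _ IH | G F1 F2 _ IH1 _ IH2
    | G R F1 F2 _ IH1 _ IH2 | G F1 F2 _ IH | G F1 F2 _ IH
    | G R F1 F2 _ IH1 _ IH2 | G F1 F2 _ IH | G F _ IH | G F _ IH
    | G R F t _ IH | G F _ IH | G R F _ IH | G F t _ IH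
    | G R F _ IH | G R F _ IH | G F _ IH]; intros L E HL HE.
  - subst G'.
    apply Permutation_map_inv in HG; destruct HG as (L' & HG & HL).
    apply lk_exch with (lefts L') (E ++ rights L').
    + now apply Permutation_flat_map, Permutation_sym.
    + now apply Permutation_app_head, Permutation_flat_map, Permutation_sym.
    + auto.
  - destruct L as [| a L]; [discriminate HL |].
    injection HL as Ha _.
    (* The identity is applied to the head; the rest of the context is weakened in on both sides. *)
    change (a :: L) with ([a] ++ L); unfold lefts, rights.
    rewrite !flat_map_app, app_assoc.
    now apply lk_weaken, lk_identity with F.
  - case_hyp L HL A HG.
    apply lk_andL, (IH (inl A1 :: inl A2 :: L)); simpl; congruence.
  - case_concl HE C HC; subst F1 F2.
    apply lk_andR; [apply (IH1 L [C1]) | apply (IH2 L [C2])];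
      auto using concl_nn.
  - case_hyp L HL A HG; subst F1 F2 G.
    apply lk_orL; [apply (IH1 (inl A1 :: L)) | apply (IH2 (inl A2 :: L))]; auto.
  - case_concl HE C HC; subst F1 F2.
    (* The classical rule keeps both disjuncts; the one not chosen is weakened in. *)
    apply lk_orR, lk_exchR with ([C2; C1] ++ rights L); [apply perm_swap |].
    apply lk_weakR, (IH L [C1]); auto using concl_nn.
  - case_concl HE C HC; subst F1 F2.
    apply lk_orR, lk_weakR, (IH L [C2]); auto using concl_nn.
  - case_hyp L HL A HG; subst F1 F2 G.
    apply lk_impL.
    (* The first intuitionistic premiss has dropped [E]; weakening restores it. *)
    + apply lk_exchR with (([A1] ++ rights L) ++ E);
        [apply perm_skip, Permutation_app_comm |].
      apply lk_weakenR, IH1; auto using concl_nn.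
    + apply (IH2 (inl A2 :: L)); auto.
  - case_concl HE C HC; subst F1 F2 G.
    apply lk_impR, (IH (inl C1 :: L) [C2]); auto using concl_nn.
  - inversion HE; subst E.
    (* [Neg F] either translates a hypothesis [Neg A] or marks a conclusion [A]; in the second case
       premiss and conclusion have the same classical reading. *)
    destruct L as [| [A | A] L]; try discriminate HL; injection HL as HL HG.
    + symmetry in HL; case_translation A HL; subst F.
      apply lk_negL, (IH L [A]); auto using concl_kneg.
    + subst F; apply (IH L [A]); auto using concl_kneg.
  - apply concl_Some_inv in HE; destruct HE as (C & -> & [HC | HC]).
    + symmetry in HC; case_translation C HC; subst F G.
      apply lk_negR, (IH (inl C :: L) []); auto using concl_none.
    (* Conversely, [C] moves from the right into the context as [inr C], and the classical sequent
       is unchanged. *)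
    + injection HC as HC; subst F G.
      apply (IH (inr C :: L) []); auto using concl_none.
  - case_hyp L HL A HG; subst F G.
    apply lk_allL with t, (IH (inl (inst t A) :: L)); auto.
    simpl; unfold inst; now rewrite kpos_subst.
  - case_concl HE C HC; subst F G.
    apply lk_allR; rewrite <- lefts_shift, <- rights_shift.
    apply (IH _ [C]); auto using concl_nn, hyp_shift.
  - case_hyp L HL A HG; subst F G.
    apply lk_exL; rewrite map_app, <- lefts_shift, <- rights_shift.
    apply (IH (inl A :: map (@shift_hyp S) L)); auto using concl_shift.
    simpl; now rewrite hyp_shift.
  - case_concl HE C HC; subst F.
    apply lk_exR with t, (IH L [inst t C]); auto.
    unfold inst; simpl; rewrite <- kneg_subst; apply concl_nn.
  - destruct L as [| a L]; [discriminate HL |].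
    injection HL as Ha HG; subst F G.
    specialize (IH (a :: a :: L) E eq_refl HE).
    (* Left contraction of an [inr] formula becomes classical right contraction. *)
    destruct a as [A | A]; simpl in *; [now apply lk_contrL |].
    apply lk_exchR with (A :: E ++ rights L); [apply Permutation_middle |].
    apply lk_contrR; revert IH; apply lk_exchR.
    rewrite (Permutation_app_comm E), (Permutation_app_comm E); reflexivity.
  - destruct L as [| a L]; [discriminate HL |].
    injection HL as Ha HG; subst F G.
    specialize (IH L E eq_refl HE).
    destruct a as [A | A]; simpl; [now apply lk_weakL |].
    apply lk_exchR with (A :: E ++ rights L); [apply Permutation_middle |].
    now apply lk_weakR.
  - apply concl_Some_inv in HE; destruct HE as (C & -> & _).
    apply lk_weakR, (IH L []); auto using concl_none.
Qed.

Theorem theorem2 (S : signature) (Gamma Delta : list (formula S))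
    (D : formula S) :
  lj (map (@kpos S) Gamma ++ map (fun A => Neg (kneg A)) Delta)
     (Some (kneg D)) ->
  lk Gamma (Delta ++ [D]).
Proof.
  intros H.
  apply lk_of_lj with (L := map inl Gamma ++ map inr Delta) (E := [D]) in H;
    [| now rewrite map_app, !map_map | apply concl_kneg].
  revert H; apply lk_exch.
  - replace (lefts _) with Gamma; [reflexivity |].
    induction Gamma; simpl; [induction Delta; auto | f_equal; auto].
  (* [D] stands first in the reading and last in the goal. *)
  - replace (rights _) with Delta; [apply (Permutation_app_comm [D]) |].
    induction Gamma; simpl; [induction Delta; simpl; f_equal; auto | auto].
Qed.
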